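(* If $\mathcal{R}$ is a Urysohn monoid, then $\mathrm{Th}(\mathcal{U}_{\mathcal{R}})$ does not have the finitary strong order property.
   Context: A distance monoid is a structure $\mathcal{R}=(R,\oplus,\leq,0)$ such that $(R,\oplus,0)$ is a commutative monoid and $\leq$ is a total, translation-invariant order on $R$ with least element $0$. An $\mathcal{R}$-metric space is a set $A$ with a symmetric function $d:A\times A\to R$ such that $d(x,y)=0$ iff $x=y$, and $d(x,z)\leq d(x,y)\oplus d(y,z)$ for all $x,y,z\in A$. For countable $\mathcal{R}$, the $\mathcal{R}$-Urysohn space $\mathcal{U}_{\mathcal{R}}$ is the unique (up to isometry) countable $\mathcal{R}$-metric space that is ultrahomogeneous and contains an isometric copy of every finite $\mathcal{R}$-metric space. It is viewed as a structure in the relational language $\mathcal{L}_R=\{d(x,y)\leq r:r\in R\}$ of binary relations, and $\mathrm{Th}(\mathcal{U}_{\mathcal{R}})$ is its complete $\mathcal{L}_R$-theory. A Urysohn monoid is a countable distance monoid $\mathcal{R}$ such that $\mathrm{Th}(\mathcal{U}_{\mathcal{R}})$ has quantifier elimination in $\mathcal{L}_R$. Let $T$ be a complete theory with sufficiently saturated monster model $\mathbb{M}$. Tuples may be infinite, but of length smaller than $|\mathbb{M}|$; indiscernible means order indiscernible. Let $\mathcal{I}=(\bar a^l)_{l<\omega}$ be an indiscernible sequence in $\mathbb{M}$, and let $p(\bar x,\bar y)=\mathrm{tp}(\bar a^0,\bar a^1)$. For $n>0$, $\mathcal{I}$ is $n$-cyclic if $p(\bar x^1,\bar x^2)\cup p(\bar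 x^2,\bar x^3)\cup\ldots\cup p(\bar x^{n-1},\bar x^n)\cup p(\bar x^n,\bar x^1)$ is consistent (for $n=1$: $p(\bar x^1,\bar x^1)$ is consistent). The set of non-parameter indices is $\mathrm{NP}(\mathcal{I})=\{i\in\ell(\bar a^0):a^0_i\neq a^1_i\}$, where $\ell(\bar a^0)$ is the index set of the tuple. $T$ has the finitary strong order property if there is an indiscernible sequence $\mathcal{I}$ such that $\mathrm{NP}(\mathcal{I})$ is finite and $\mathcal{I}$ is not $n$-cyclic for any $n>0$. *)

(* Defs.v *)
From mathcomp Require Import all_boot all_order.
From mathcomp Require Import boolp classical_sets functions cardinality.

Set Implicit Arguments.
Unset Strict Implicit.
Unset Printing Implicit Defensive.

Import Order.TTheory.
Local Open Scope classical_set_scope.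
Local Open Scope order_scope.

Record distanceMonoid (d : Order.disp_t) := DistanceMonoid {
  dm_order :> orderType d ;
  dm0 : dm_order ;
  oplus : Monoid.com_law dm0 ;
  dm_ge0 : forall r, dm0 <= r ;
  dm_le_oplus2r : forall r s t, r <= s -> oplus r t <= oplus s t
}.

Record metric_space (d : Order.disp_t) (R : distanceMonoid d) := MetricSpace {
  point :> Type ;
  dist : point -> point -> R ;
  dist_sym : forall x y, dist x y = dist y x ;
  dist_eq0 : forall x y, dist x y = dm0 R <-> x = y ;
  dist_triangle : forall x y z, dist x z <= oplus R (dist x y) (dist y z)
}.

Section Urysohn.
Variables (d : Order.disp_t) (R : distanceMonoid d).

Definition isometric_on (A B : metric_space R) (X : set A) (f : A -> B) : Prop :=
  forall x y, X x -> X y -> dist (f x) (f y) = dist x y.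

Definition isometric_embedding (A B : metric_space R) (f : A -> B) : Prop :=
  isometric_on [set: A] f.

Definition ultrahomogeneous (U : metric_space R) : Prop :=
  forall (X : set U) (f : U -> U), finite_set X -> isometric_on X f ->
  exists g : U -> U,
    [/\ isometric_embedding g, bijective g & forall x, X x -> g x = f x].

Definition finitely_universal (U : metric_space R) : Prop :=
  forall A : metric_space R, finite_set [set: A] ->
  exists f : A -> U, isometric_embedding f.

(* For countable [R] this determines [U] up to isometry, so that [U] is "the"
   R-Urysohn space. *)
Definition is_urysohn_space (U : metric_space R) : Prop :=
  [/\ countable [set: U], ultrahomogeneous U & finitely_universal U].

End Urysohn.

(* First-order logic with equality over a language whose only symbols are the
   binary relation symbols in [S]. [formula S V] is the type of formulas with
   free variables in [V]; the variable bound by [FAll] is [None]. The other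
   connectives and the existential quantifier are classically definable. *)
Inductive formula (S V : Type) : Type :=
| FFalse
| FEq of V & V
| FRel of S & V & V
| FImp of formula S V & formula S V
| FAll of formula S (option V).

Arguments FFalse {S V}.
Arguments FEq {S V}.
Arguments FRel {S V}.
Arguments FImp {S V}.
Arguments FAll {S V}.

Record structure (S : Type) := Structure {
  carrier :> Type ;
  interp : S -> carrier -> carrier -> Prop
}.

Section Logic.
Variable S : Type.

Fixpoint sat (M : structure S) (V : Type) (a : V -> M) (phi : formula S V) : Prop :=
  match phi in formula _ _ return Prop with
  | FFalse => False
  | FEq x y => a x = a y
  | FRel s x y => interp s (a x) (a y)
  | FImp f g => sat a f -> sat a g
  | FAll f => forall m : M, sat (oapp a m) f
  end.

Fixpoint rename (V W : Type) (h : V -> W) (phi : formula S V) : formula S W :=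
  match phi in formula _ _ return formula S W with
  | FFalse => FFalse
  | FEq x y => FEq (h x) (h y)
  | FRel s x y => FRel s (h x) (h y)
  | FImp f g => FImp (rename h f) (rename h g)
  | FAll f => FAll (rename (omap h) f)
  end.

Fixpoint quantifier_free (V : Type) (phi : formula S V) : Prop :=
  match phi with
  | FImp f g => quantifier_free f /\ quantifier_free g
  | FAll _ => False
  | _ => True
  end.

Definition theory := set (formula S void).

Definition Th (M : structure S) : theory := [set phi | sat (of_void M) phi].

Definition models (M : structure S) (T : theory) : Prop := T `<=` Th M.

Definition quantifier_elimination (T : theory) : Prop :=
  forall (n : nat) (phi : formula S 'I_n), exists psi : formula S 'I_n,
    quantifier_free psi /\
    forall M : structure S, models M T ->
    forall a : 'I_n -> M, sat a phi <-> sat a psi.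

(* [tp a] is the complete type, over the empty set, of the tuple [a]. *)
Definition tp (M : structure S) (V : Type) (a : V -> M) : set (formula S V) :=
  [set phi | sat a phi].

Definition consistent (T : theory) (V : Type) (Sigma : set (formula S V)) : Prop :=
  exists2 M : structure S, models M T &
  exists a : V -> M, forall phi, Sigma phi -> sat a phi.

(* In a sequence of tuples [a : nat -> I -> M], the element [a l i] is the i-th
   coordinate of the l-th tuple; the index set [I] may be infinite. *)

Definition indiscernible (M : structure S) (I : Type) (a : nat -> I -> M) : Prop :=
  forall (n : nat) (s t : 'I_n -> nat),
    (forall j k : 'I_n, (j < k)%N -> (s j < s k)%N) ->
    (forall j k : 'I_n, (j < k)%N -> (t j < t k)%N) ->
    tp (fun v : 'I_n * I => a (s v.1) v.2) = tp (fun v : 'I_n * I => a (t v.1) v.2).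

(* p(x,y) = tp(a^0, a^1), with x indexed by the left and y by the right copy
   of [I]. *)
Definition type01 (M : structure S) (I : Type) (a : nat -> I -> M) :
    set (formula S (I + I)) :=
  tp (fun v => match v with inl i => a 0%N i | inr i => a 1%N i end).

(* p(x^j, x^k), for tuples of variables x^0, ..., x^(n-1) indexed by [I]. *)
Definition subst_type (I : Type) (p : set (formula S (I + I))) (n : nat) (j k : 'I_n) :
    set (formula S ('I_n * I)) :=
  rename (fun v => match v with inl i => (j, i) | inr i => (k, i) end) @` p.

(* [ordS j] is j + 1 modulo n. *)
Definition cyclic_seq (T : theory) (M : structure S) (I : Type) (a : nat -> I -> M)
    (n : nat) : Prop :=
  consistent T (\bigcup_(j in [set: 'I_n]) subst_type (type01 a) j (ordS j)).

Definition NP (M : structure S) (I : Type) (a : nat -> I -> M) : set I :=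
  [set i | a 0%N i <> a 1%N i].

(* For a complete theory [T]. Instead of fixing a monster model, [M] ranges over
   all models of [T] and consistency is consistency with [T]. Every model embeds
   elementarily in a sufficiently saturated one, where a small set of formulas
   consistent with [T] is realized; hence no bound on the size of the index set
   [I] is needed either. *)
Definition finitary_strong_order_property (T : theory) : Prop :=
  exists (M : structure S) (I : Type) (a : nat -> I -> M),
    [/\ models M T, indiscernible a, finite_set (NP a) &
        forall n : nat, (0 < n)%N -> ~ cyclic_seq T a n].

End Logic.

(* The language has one binary relation symbol d(x,y) <= r for each [r : R]. *)
Definition metric_structure (d : Order.disp_t) (R : distanceMonoid d)
    (A : metric_space R) : structure R :=
  {| carrier := A ; interp := fun r x y => dist x y <= r |}.

Definition urysohn_monoid (d : Order.disp_t) (R : distanceMonoid d) : Prop :=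
  countable [set: R] /\
  forall U : metric_space R, is_urysohn_space U ->
    quantifier_elimination (Th (metric_structure U)).

(* Main.v *)
Require Import Defs.
From mathcomp Require Import all_boot all_order.
From mathcomp Require Import ssralg ssrnum ssrint zify.
From mathcomp Require Import boolp classical_sets functions cardinality filter.

(** The theory of the Urysohn space lacks the finitary strong order property
    because every indiscernible sequence [a] in which at most [N - 1]
    coordinates move is [n]-cyclic for every [n] that is large compared with [N];
    the proof uses [n = N + 3].

    Reduction to finite metric spaces.  By compactness ([compactness], proved
    with an ultrapower of [U]) it is enough to satisfy finitely many formulas of
    the cyclic type, and to do so in [U] itself.  Quantifier elimination makes
    each such formula depend only on the truth, for finitely many distances [r]
    and finitely many coordinates, of the relations [d(x, y) <= r]
    ([qe_finitely_determined]).  So one has to place finitely many points in [U],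
    arranged in [n] levels around a circle, such that the distances inside a
    level and between consecutive levels lie, with respect to a finite set [Q] of
    distances, in the same cuts as the distances of [a].

    The metric space.  Give two points at the same or at consecutive levels the
    least element of [Q] that bounds the corresponding distance of [a], and every
    other pair a weight [B] that exceeds all elements of [Q], or is the maximum of
    [R] if no element of [R] does; [B] also serves where [Q] has no bound.  The path
    metric of these weights is finite, so after identification of the points at
    distance zero it embeds in [U].  The path metric never exceeds the weights;
    what must be shown is that no detour around the circle is shorter than the
    prescribed bound ([cycle_path_dist]).

    Detours.  Lift a walk on the circle to a walk over the integers.  In the model
    it becomes a chain [a^k_i, a^l_j, ...] of points whose steps have the
    prescribed distances, so by the triangle inequality its total cost bounds
    [d(a^k_i, a^l_j)] for its end points.  If the walk does not go around the
    circle, this is the required bound.  If it does, it passes at least [N]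
    consecutive levels, and by the pigeonhole principle it either meets a
    coordinate that does not move, or meets the same coordinate [i] at two
    different levels.  A coordinate that does not move lets the chain jump to any
    level at no cost.  In the other case the part of the walk between the two
    visits costs at least [d(a^0_i, a^1_i)], which by indiscernibility pays for a
    jump from [a^k_i] to any [a^l_i].  Hence the cost bounds the distance between
    the two coordinates at all pairs of levels, in particular the required one
    ([lag_rigid_rcons], [lag_rigid_bound]). *)

Set Implicit Arguments.
Unset Strict Implicit.
Unset Printing Implicit Defensive.

Import Order.TTheory.
Local Open Scope classical_set_scope.
Local Open Scope order_scope.

Local Notation "x ⊕ y" := (oplus _ x y) (at level 50, left associativity).

(** * Path metrics and their embedding in universal spaces *)

Section PathMetric.
Variables (d : Order.disp_t) (R : distanceMonoid d).
Local Notation "0" := (dm0 R).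

Lemma le_oplus (r s t u : R) : r <= s -> t <= u -> r ⊕ t <= s ⊕ u.
Proof.
move=> rs tu; apply: (le_trans (dm_le_oplus2r t rs)).
by rewrite ![oplus R s _]Monoid.mulmC; exact: dm_le_oplus2r.
Qed.

Lemma le_oplusl (r s : R) : r <= r ⊕ s.
Proof. by rewrite -{1}[r](Monoid.mulm1 (oplus R)) le_oplus ?dm_ge0. Qed.

Lemma le_oplusr (r s : R) : s <= r ⊕ s.
Proof. by rewrite Monoid.mulmC le_oplusl. Qed.

Inductive walk_cost (V : Type) (w : V -> V -> R) (x : V) : V -> R -> Prop :=
| walk_nil : walk_cost w x x 0
| walk_rcons y z c : walk_cost w x y c -> walk_cost w x z (c ⊕ w y z).

Lemma walk_cat (V : Type) (w : V -> V -> R) x y z a b :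
  walk_cost w x y a -> walk_cost w y z b -> walk_cost w x z (a ⊕ b).
Proof.
move=> xy; elim=> [|u v c _ IH]; first by rewrite Monoid.mulm1.
by rewrite Monoid.mulmA; exact: walk_rcons.
Qed.

(** The Floyd-Warshall recursion: the least cost of a walk from [x] to [y] that
    uses only intermediate vertices from [s]. *)
Fixpoint path_dist (V : Type) (w : V -> V -> R) (s : seq V) (x y : V) : R :=
  if s is z :: s' then
    Order.min (path_dist w s' x y) (path_dist w s' x z ⊕ path_dist w s' z y)
  else w x y.

Lemma path_dist_le (V : Type) (w : V -> V -> R) s x y : path_dist w s x y <= w x y.
Proof. by elim: s x y => //= z s IH x y; rewrite ge_min IH. Qed.

Lemma path_dist_sym (V : Type) (w : V -> V -> R) s :
  (forall x y, w x y = w y x) -> forall x y, path_dist w s x y = path_dist w s y x.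
Proof.
move=> wC; elim: s => //= z s IH x y.
by rewrite (IH x y) (IH x z) (IH z y) [oplus R _ _]Monoid.mulmC.
Qed.

Lemma path_dist_walk (V : Type) (w : V -> V -> R) s x y :
  walk_cost w x y (path_dist w s x y).
Proof.
elim: s x y => /= [x y|z s IH x y].
  by rewrite -[w x y](Monoid.mul1m (oplus R)); apply: walk_rcons; exact: walk_nil.
by rewrite minEle; case: ifP => _ //; exact: walk_cat (IH _ _) (IH _ _).
Qed.

(** A detour through [z] may pass through [z] more than once; dropping the loop
    only makes it cheaper, since distances are nonnegative.  This gives the
    inequality for the vertex added last; for an earlier vertex it follows from
    the inequality for the smaller set, in each of the four cases of the two
    minima on the right. *)
Lemma path_dist_triangle (V : eqType) (w : V -> V -> R) s x y z : z \in s ->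
  path_dist w s x y <= path_dist w s x z ⊕ path_dist w s z y.
Proof.
elim: s x y z => //= v s; set f := path_dist w s => IH x y z.
rewrite inE => /orP[/eqP ->|zs].
  have toz a : Order.min (f a v) (f a v ⊕ f v v) = f a v by rewrite min_l ?le_oplusl.
  have ofz a : Order.min (f v a) (f v v ⊕ f v a) = f v a by rewrite min_l ?le_oplusr.
  by rewrite toz ofz ge_min lexx orbT.
have xy := IH x y z zs; have xv := IH x v z zs; have vy := IH v y z zs.
rewrite ge_min; apply/orP.
rewrite [Order.min (f x z) _]minEle [Order.min (f z y) _]minEle.
case: ifP => _; case: ifP => _.
- by left.
- right; rewrite Monoid.mulmA; exact: dm_le_oplus2r.
- right; rewrite -Monoid.mulmA; exact: le_oplus.
- right; apply: le_oplus.
    by rewrite le_oplusl.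
  by rewrite le_oplusr.
Qed.

Definition pseudometric (V : Type) (rho : V -> V -> R) : Prop :=
  [/\ forall x, rho x x = 0, forall x y, rho x y = rho y x
    & forall x y z, rho x z <= rho x y ⊕ rho y z].

Lemma path_pseudometric (V : finType) (w : V -> V -> R) :
  (forall x, w x x = 0) -> (forall x y, w x y = w y x) ->
  pseudometric (path_dist w (enum V)).
Proof.
move=> w0 wC; split=> [x|x y|x y z]; last 1 first.
- by apply: path_dist_triangle; rewrite mem_enum.
- by apply/eqP; rewrite eq_le dm_ge0 andbT -[X in _ <= X](w0 x) path_dist_le.
- exact: path_dist_sym.
Qed.

(** Vertices at distance zero are identified by the choice of a representative of
    each class; this is needed because coordinates that do not move, or repeated
    entries of a tuple, give such vertices. *)
Lemma pseudometric_embeds (U : metric_space R) (V : finType) (rho : V -> V -> R) :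
  finitely_universal U -> pseudometric rho ->
  exists f : V -> U, forall x y, dist (f x) (f y) = rho x y.
Proof.
move=> univ [rho0 rhoC rhoT].
have eq0l x y z : rho x y = 0 -> rho x z = rho y z.
  move=> xy; apply/eqP; rewrite eq_le.
  have := rhoT x y z; have := rhoT y x z.
  by rewrite (rhoC y x) xy !Monoid.mul1m => -> ->.
pose rep x := odflt x [pick y | rho x y == 0].
have rhorep x : rho x (rep x) = 0.
  by rewrite /rep; case: pickP => [y /eqP //|/(_ x)]; rewrite rho0 eqxx.
have repE x y : rho x y = 0 -> rep x = rep y.
  move=> xy; rewrite /rep (eq_pick (fun z => congr1 (eq_op^~ 0) (eq0l x y z xy))).
  by case: pickP => [//|/(_ y)]; rewrite rho0 eqxx.
have repK x : rep (rep x) == rep x by rewrite -(repE _ _ (rhorep x)).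
pose Q := {x : V | rep x == x}.
pose dQ (u v : Q) := rho (val u) (val v).
have dQ0 u v : dQ u v = 0 <-> u = v.
  split=> [uv|->]; last exact: rho0.
  by apply: val_inj; rewrite -(eqP (valP u)) -(eqP (valP v)); exact: repE.
have [g gP] := univ (MetricSpace (fun u v => rhoC (val u) (val v)) dQ0
  (fun u v t => rhoT (val u) (val v) (val t))) (finite_finset (T := Q)).
pose cls x : Q := exist _ (rep x) (repK x).
exists (fun x => g (cls x)) => x y.
have -> : dist (g (cls x)) (g (cls y)) = rho (rep x) (rep y) by exact: gP.
rewrite (rhoC x) (eq0l _ _ x (rhorep y)) (rhoC _ x); exact/esym/eq0l/rhorep.
Qed.

Lemma finitely_universal_inhabited (U : metric_space R) :
  finitely_universal U -> exists u : U, True.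
Proof.
move=> univ; have [f _] := @pseudometric_embeds _ unit (fun _ _ => 0) univ
  (And3 (fun=> erefl) (fun _ _ => erefl) (fun _ _ _ => dm_ge0 _)).
by exists (f tt).
Qed.

End PathMetric.

(** * Walks over the integers *)

(** For an indiscernible sequence [a] the truth of [d(a^k_i, a^l_j) <= r] depends
    only on [r], [i], [j] and the lag [z = l - k]; [K r z i j] stands for it, and
    [P] for the set of coordinates that move.  [lag_loop] holds because all the
    distances [d(a^k_i, a^l_i)] with [k <> l] are equal. *)
Record lag_metric (d : Order.disp_t) (R : distanceMonoid d) (I : Type) (P : set I)
    (K : R -> int -> I -> I -> Prop) : Prop := {
  lag_mono : forall r s z i j, r <= s -> K r z i j -> K s z i j ;
  lag_top : forall r z i j, (forall s, s <= r) -> K r z i j ;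
  lag_refl : forall i, K (dm0 R) 0%Z i i ;
  lag_sym : forall r z i j, K r z i j -> K r (- z)%R j i ;
  lag_triangle : forall r s y z i j k,
    K r y i j -> K s z j k -> K (oplus R r s) (y + z)%R i k ;
  lag_loop : forall r y z i, y != 0%Z -> K r y i i -> K r z i i ;
  lag_const : forall z i, ~ P i -> K (dm0 R) z i i
}.

Section LagWalks.
Variables (d : Order.disp_t) (R : distanceMonoid d) (I : Type) (P : set I).
Variable K : R -> int -> I -> I -> Prop.
Hypothesis KP : lag_metric P K.

(** Walks around the circle turn out to have free cost; such a cost bounds the
    prescribed distance whatever the number of turns is. *)
Definition lag_free (c : R) (i j : I) : Prop := forall z, K c z i j.

(** The history of a walk of total lag [l] from [i] to [j] that has not become
    free: [Vis m k] says that coordinate [k] has been visited at level [m].  All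
    levels between [0] and [l] are visited, no coordinate is visited at two levels,
    and the cost splits at each visit into a part that pays for the way to it and a
    part that pays for the way back to the end of the walk. *)
Definition lag_rigid (c : R) (l : int) (i j : I) : Prop :=
  exists Vis : int -> I -> Prop,
  [/\ Vis l j,
      forall m, ((0 <= m <= l) || (l <= m <= 0))%R -> exists k, Vis m k,
      forall m k, Vis m k -> P k,
      forall m m' k, Vis m k -> Vis m' k -> m = m'
    & forall m k, Vis m k -> exists a b,
        [/\ c = a ⊕ b, K a m i k & K b (l - m)%R k j]].

(** The loop at [k] of nonzero lag can be replaced by a loop of any lag, at the
    same cost, so that the total lag becomes arbitrary. *)
Lemma lag_free_loop a b c x y z i k j :
  y != 0%Z -> K a x i k -> K b y k k -> K c z k j -> lag_free (a ⊕ b ⊕ c) i j.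
Proof.
move=> y0 Ka Kb Kc t; have {}Kb := lag_loop KP (t - x - z)%R y0 Kb.
have -> : t = (x + (t - x - z) + z)%R by lia.
exact: (lag_triangle KP (lag_triangle KP Ka Kb) Kc).
Qed.

Lemma lag_free_const a b x y i k j :
  ~ P k -> K a x i k -> K b y k j -> lag_free (a ⊕ b) i j.
Proof.
move=> Pk Ka Kb t; rewrite -[a](Monoid.mulm1 (oplus R)).
apply: (@lag_free_loop _ _ _ x 1 y _ k) => //; exact: (lag_const KP).
Qed.

Lemma lag_rigidK c l i j : lag_rigid c l i j -> K c l i j.
Proof.
case=> Vis [Vl _ _ _ /(_ _ _ Vl)[a [b [-> Ka Kb]]]].
have -> : l = (l + (l - l))%R by lia.
exact: (lag_triangle KP Ka Kb).
Qed.

Lemma lag_walk0 i : lag_free (dm0 R) i i \/ lag_rigid (dm0 R) 0 i i.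
Proof.
have [Pi|nPi] := pselect (P i); last by left=> z; exact: (lag_const KP).
right; exists (fun m k => m = 0%Z /\ k = i); split=> //.
- by move=> m m0; exists i; split=> //; lia.
- by move=> m k [_ ->].
- by move=> m m' k [-> _] [-> _].
- move=> m k [-> ->]; exists (dm0 R), (dm0 R).
  by rewrite Monoid.mulm1; split=> //; exact: (lag_refl KP).
Qed.

Lemma lag_free_rcons c r z i j k : lag_free c i j -> K r z j k -> lag_free (c ⊕ r) i k.
Proof.
move=> Kc Kr t; have -> : t = (t - z + z)%R by lia.
exact: (lag_triangle KP (Kc _) Kr).
Qed.

(** The new point is at a coordinate that does not move, or at a coordinate seen
    before at another level, and then the walk becomes free; or else it can be added
    to the history.  As steps have lag at most one, no level is skipped. *)
Lemma lag_rigid_rcons c l r z i j k :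
  lag_rigid c l i j -> (-1 <= z <= 1)%R -> K r z j k ->
  lag_free (c ⊕ r) i k \/ lag_rigid (c ⊕ r) (l + z) i k.
Proof.
move=> cl z1 Kr; have Kc := lag_rigidK cl.
have [Pk|nPk] := pselect (P k); last first.
  left; rewrite -[_ ⊕ r](Monoid.mulm1 (oplus R)).
  exact: (lag_free_const nPk (lag_triangle KP Kc Kr) (lag_refl KP k)).
have [Vis [Vl Vcov VP Vfun Vdec]] := cl.
have [[m [Vm ml]]|nV] := pselect (exists m, Vis m k /\ m <> (l + z)%R).
  have [a [b [-> Ka Kb]]] := Vdec _ _ Vm; left.
  have -> : a ⊕ b ⊕ r = a ⊕ (b ⊕ r) ⊕ dm0 R by rewrite Monoid.mulm1 Monoid.mulmA.
  have lm : (l - m + z)%R != 0%Z by lia.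
  exact: (lag_free_loop lm Ka (lag_triangle KP Kb Kr) (lag_refl KP k)).
right; exists (fun m n => Vis m n \/ m = (l + z)%R /\ n = k); split.
- by right.
- move=> m mlz; have [->|ml] := eqVneq m (l + z)%R; first by exists k; right.
  by have [|n Vn] := Vcov m; [lia|exists n; left].
- by move=> m n [/VP//|[_ ->]].
- have agree m : Vis m k -> m = (l + z)%R.
    by move=> Vm; apply: contrapT => ml; apply: nV; exists m.
  move=> m m' n [Vm|[-> ->]] [Vm'|[-> nk]] //.
  + exact: Vfun Vm Vm'.
  + by apply: agree; rewrite -nk.
  + exact/esym/agree.
- move=> m n [/Vdec[a [b [-> Ka Kb]]]|[-> ->]].
    exists a, (b ⊕ r); rewrite Monoid.mulmA; split=> //.
    have -> : (l + z - m = (l - m) + z)%R by lia.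
    exact: (lag_triangle KP Kb Kr).
  exists (c ⊕ r), (dm0 R); rewrite Monoid.mulm1; split=> //.
    exact: (lag_triangle KP Kc Kr).
  have -> : (l + z - (l + z) = 0)%R by lia.
  exact: (lag_refl KP).
Qed.

(** A rigid walk visits distinct moving coordinates at all the levels that it
    crosses. *)
Lemma lag_rigid_bound N c l i j :
  (forall f : 'I_N -> I, injective f -> exists k, ~ P (f k)) ->
  lag_rigid c l i j -> (`|l| < N)%N.
Proof.
move=> pigeon [Vis [_ Vcov VP Vfun _]]; rewrite ltnNge; apply/negP => Nl.
pose lev (k : 'I_N) : int := if (0 <= l)%R then Posz k else (- Posz k)%R.
have levV k : exists n, Vis (lev k) n.
  by apply: Vcov; rewrite /lev; have := ltn_ord k; case: ifP; lia.
have [f fV] := choice levV.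
have [|k] := pigeon f; last by apply; exact: VP (fV k).
move=> k k' ff; have := fV k; rewrite ff => /Vfun/(_ (fV k')).
by move=> e; apply: val_inj; move: e; rewrite /lev /=; case: ifP; lia.
Qed.

End LagWalks.

(** * Metric spaces arranged in a circle *)

Section Cutoff.
Variables (d : Order.disp_t) (R : distanceMonoid d).

(** The least element of [Q] satisfying [A], or [B] if there is none.  When [A r]
    says that a distance of a model, possibly not realized in [R], is at most [r],
    this is the best upper approximation of that distance in [Q]. *)
Definition cutoff (Q : seq R) (B : R) (A : R -> Prop) : R :=
  foldr (fun r m => if `[< A r >] then Order.min r m else m) B Q.

Lemma cutoff_or Q B A : cutoff Q B A = B \/ A (cutoff Q B A).
Proof.
elim: Q => [|r Q IH] /=; first by left.
by case: asboolP => // Ar; rewrite minEle; case: ifP => _; [right|].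
Qed.

Lemma cutoffP Q B A r :
  (forall x y, x <= y -> A x -> A y) -> (forall x, (forall y : R, y <= x) -> A x) ->
  (forall x, x \in Q -> B <= x -> forall y, y <= x) -> r \in Q ->
  cutoff Q B A <= r <-> A r.
Proof.
move=> Amono Atop Bmax rQ; split=> [cr|Ar]; last first.
  elim: Q rQ {Bmax} => // x Q IH; rewrite inE => /orP[/eqP <-|/IH le_r] /=.
    by rewrite asboolT // ge_min lexx.
  by case: ifP => // _; rewrite ge_min le_r orbT.
have [cB|] := cutoff_or Q B A; last exact: Amono.
by apply: Atop; apply: Bmax => //; rewrite -cB.
Qed.

(** If nothing lies strictly above [Q], the maximum of [Q] is the maximum of [R],
    and can serve as [B]. *)
Lemma exists_cap_weight (Q : seq R) :
  exists B, forall r, r \in Q -> B <= r -> forall s, s <= r.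
Proof.
have [[b bP]|nb] := pselect (exists b, forall r, r \in Q -> r < b).
  by exists b => r rQ br; have := bP r rQ; rewrite ltNge br.
have [m mP] : exists m, m \in dm0 R :: Q /\ forall r, r \in Q -> r <= m.
  elim: Q {nb} => [|x Q [m [mQ mP]]]; first by exists (dm0 R); rewrite mem_head.
  exists (Order.max x m); split=> [|r].
    rewrite maxEle; case: ifP => _; last by rewrite !inE eqxx orbT.
    by move: mQ; rewrite !inE => /orP[->|->]; rewrite ?orbT.
  by rewrite inE le_max => /orP[/eqP->|/mP->]; rewrite ?lexx ?orbT.
exists m => r rQ mr s.
rewrite leNgt; apply/negP => rs; apply: nb; exists s => t /mP.2 tm.
exact: le_lt_trans (le_trans tm mr) rs.
Qed.

End Cutoff.

Lemma ordSE (N : nat) (j : 'I_N.+3) :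
  (ordS j = j.+1 :> nat) \/ (ordS j = 0%N :> nat /\ j = N.+2 :> nat).
Proof.
have := ltn_ord j; rewrite ltnS leq_eqVlt => /orP[/eqP jN|jN] /=.
  by right; rewrite jN modnn.
by left; rewrite modn_small.
Qed.

Lemma ordS_cycle_neq (N : nat) (j : 'I_N.+3) : ordS j != j /\ ordS (ordS j) != j.
Proof.
have := ordSE j; have := ordSE (ordS j).
by split; apply/eqP => /(congr1 (@nat_of_ord _)); lia.
Qed.

Section CyclicMetric.
Variables (d : Order.disp_t) (R : distanceMonoid d) (I : choiceType) (P : set I).
Variable K : R -> int -> I -> I -> Prop.
Hypothesis KP : lag_metric P K.
Variables (N : nat) (E : seq I) (Q : seq R).
Hypothesis pigeonhole : forall f : 'I_N -> I, injective f -> exists k, ~ P (f k).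

Local Notation n := N.+3.
Local Notation V := ('I_n * seq_sub E)%type.

Variable B : R.
Hypothesis Q0 : dm0 R \in Q.
Hypothesis Qtop : forall r, r \in Q -> B <= r -> forall s, s <= r.

Definition lag_weight (z : int) (i j : I) : R := cutoff Q B (fun r => K r z i j).

Lemma lag_weightP r z i j : r \in Q -> lag_weight z i j <= r <-> K r z i j.
Proof.
move=> rQ; apply: cutoffP => // [x y xy|x xtop]; first exact: (lag_mono KP).
exact: (lag_top KP).
Qed.

Lemma lag_weightN z i j : lag_weight (- z)%R j i = lag_weight z i j.
Proof.
congr (cutoff Q B _); apply/funext => r; apply/propext.
split=> /(lag_sym KP) //; have -> : (- - z = z)%R by lia.
by [].
Qed.

(** Levels [j] and [ordS j] are consecutive on the circle, and the second
    components are coordinates.  As there are at least three levels, at most one of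
    the first three cases applies. *)
Definition cycle_weight (x y : V) : R :=
  if x.1 == y.1 then lag_weight 0 (val x.2) (val y.2)
  else if y.1 == ordS x.1 then lag_weight 1 (val x.2) (val y.2)
  else if x.1 == ordS y.1 then lag_weight (-1)%R (val x.2) (val y.2)
  else B.

Lemma cycle_weight0 x : cycle_weight x x = dm0 R.
Proof.
apply/eqP; rewrite /cycle_weight eqxx eq_le dm_ge0 andbT lag_weightP //.
exact: (lag_refl KP).
Qed.

Lemma cycle_weightC x y : cycle_weight x y = cycle_weight y x.
Proof.
rewrite /cycle_weight [y.1 == x.1]eq_sym.
have [xy|xy] := eqVneq x.1 y.1; first by rewrite -lag_weightN GRing.oppr0.
have [yx|yx] := eqVneq y.1 (ordS x.1).
  by rewrite yx eq_sym (negPf (ordS_cycle_neq _).2) -lag_weightN.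
by case: ifP => // _; rewrite -lag_weightN.
Qed.

(** The integer [q] counts the crossings between the last level and level zero, so
    that walks on the circle can be lifted to walks over the integers. *)
Lemma cycle_weight_lag x y : cycle_weight x y = B \/
  exists z q : int, [/\ (-1 <= z <= 1)%R, K (cycle_weight x y) z (val x.2) (val y.2)
    & (Posz x.1 + z = Posz y.1 + q * n)%R].
Proof.
have lagK z i j : lag_weight z i j = B \/ K (lag_weight z i j) z i j by exact: cutoff_or.
rewrite /cycle_weight; case: ifP => [/eqP xy|_].
  case: (lagK 0%R (val x.2) (val y.2)) => [->|Kw]; [by left|right].
  by exists 0%R, 0%R; split=> //; rewrite xy; lia.
case: ifP => [/eqP yx|_].
  case: (lagK 1%R (val x.2) (val y.2)) => [->|Kw]; [by left|right].
  case: (ordSE x.1) => [e|[e e']]; [exists 1%R, 0%R|exists 1%R, 1%R]; split=> //.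
    by rewrite yx e; lia.
  by rewrite yx e e'; lia.
case: ifP => [/eqP yx|_]; last by left.
case: (lagK (-1)%R (val x.2) (val y.2)) => [->|Kw]; [by left|right].
case: (ordSE y.1) => [e|[e e']]; [exists (-1)%R, 0%R|exists (-1)%R, (-1)%R]; split=> //.
  by rewrite yx e; lia.
by rewrite yx e e'; lia.
Qed.

(** An edge of weight [B] makes the cost at least [B].  Along the other edges the
    walk lifts to the integers, and the lift stays rigid until it becomes free. *)
Lemma cycle_walk x y c : walk_cost cycle_weight x y c ->
  [\/ B <= c, lag_free K c (val x.2) (val y.2)
    | exists l q : int, lag_rigid P K c l (val x.2) (val y.2) /\
        (Posz x.1 + l = Posz y.1 + q * n)%R].
Proof.
elim=> [|u v {}c _ IH].
  case: (lag_walk0 KP (val x.2)) => [free|rigid]; first by apply: Or32.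
  by apply: Or33; exists 0%R, 0%R; split=> //; lia.
have [uv|[z [p [z1 Kuv uvp]]]] := cycle_weight_lag u v.
  by apply: Or31; rewrite uv le_oplusr.
case: IH => [Bc|free|[l [q [rigid xu]]]].
- by apply: Or31; apply: le_trans Bc _; exact: le_oplusl.
- by apply: Or32; exact: (lag_free_rcons KP free Kuv).
have [free|rigid'] := lag_rigid_rcons KP rigid z1 Kuv; first by apply: Or32.
by apply: Or33; exists (l + z)%R, (q + p)%R; split=> //; lia.
Qed.

(** A rigid walk has lag less than [N], which is too small for it to reach its end
    point by going around the circle.  A walk of cost at least [B] that costs at most
    [r] forces [r] to be the maximum of [R], so that nothing is to be proved. *)
Lemma cycle_path_dist (x y : V) r (z q : int) : r \in Q -> (-1 <= z <= 1)%R ->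
  (Posz x.1 + z = Posz y.1 + q * n)%R -> cycle_weight x y = lag_weight z (val x.2) (val y.2) ->
  path_dist cycle_weight (enum {: V}) x y <= r <-> K r z (val x.2) (val y.2).
Proof.
move=> rQ z1 xyz wxy; split=> [dr|Kr]; last first.
  by apply: le_trans (path_dist_le _ _ _ _) _; rewrite wxy lag_weightP.
have [Bc|free|[l [p [rigid xyl]]]] := cycle_walk (path_dist_walk cycle_weight (enum {: V}) x y).
- by apply: (lag_top KP) => s; apply: Qtop (le_trans Bc dr) _.
- exact: (lag_mono KP) dr (free z).
have lN := lag_rigid_bound pigeonhole rigid.
have <- : l = z.
  have pq : (l = z + (p - q) * n)%R by lia.
  have [h|[h|h]] : (p - q = 0 \/ 1 <= p - q \/ p - q <= -1)%R by lia.
  - by rewrite pq h; lia.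
  (* The other two cases go around the circle: the lags would differ by at least
     [N + 3], but they are less than [N] and at most one in absolute value. *)
  - nia.
  - nia.
exact: (lag_mono KP) dr (lag_rigidK KP rigid).
Qed.

End CyclicMetric.

Lemma cyclic_lag_realization (d : Order.disp_t) (R : distanceMonoid d)
    (U : metric_space R) (I : choiceType) (P : set I) (K : R -> int -> I -> I -> Prop) (N : nat)
    (E : seq I) (Q : seq R) :
  finitely_universal U -> lag_metric P K ->
  (forall f : 'I_N -> I, injective f -> exists k, ~ P (f k)) ->
  exists b : 'I_N.+3 * I -> U, forall r j i k, r \in Q -> i \in E -> k \in E ->
    (dist (b (j, i)) (b (j, k)) <= r <-> K r 0 i k) /\
    (dist (b (j, i)) (b (ordS j, k)) <= r <-> K r 1 i k).
Proof.
move=> univ KP pigeon; have [B Qtop] := exists_cap_weight (dm0 R :: Q).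
have Q0 : dm0 R \in dm0 R :: Q by rewrite mem_head.
have [u0 _] := finitely_universal_inhabited univ.
pose V := ('I_N.+3 * seq_sub E)%type.
pose w : V -> V -> R := cycle_weight K (dm0 R :: Q) B.
have w0 x : w x x = dm0 R by exact: (cycle_weight0 KP Q0 Qtop).
have wC x y : w x y = w y x by exact: (cycle_weightC KP).
have [f fP] := pseudometric_embeds univ (path_pseudometric w0 wC).
have fK (x y : V) r z (q : int) : r \in Q -> (-1 <= z <= 1)%R ->
    (Posz x.1 + z = Posz y.1 + q * N.+3)%R ->
    w x y = lag_weight K (dm0 R :: Q) B z (val x.2) (val y.2) ->
    dist (f x) (f y) <= r <-> K r z (val x.2) (val y.2).
  move=> rQ z1 xyz wxy; rewrite fP.
  by apply: (cycle_path_dist KP pigeon Q0 Qtop _ z1 xyz wxy); rewrite inE rQ orbT.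
exists (fun x : 'I_N.+3 * I => oapp (fun i => f (x.1, i)) u0 (insub x.2)).
move=> r j i k rQ iE kE; rewrite !insubT /=.
pose i' : seq_sub E := SeqSub iE; pose k' : seq_sub E := SeqSub kE.
have [Sj _] := ordS_cycle_neq j; split.
  apply: (fK (j, i') (j, k') r 0%R 0%R rQ) => //.
  by rewrite /w /cycle_weight eqxx.
have wS : w (j, i') (ordS j, k') = lag_weight K (dm0 R :: Q) B 1%R i k.
  by rewrite /w /cycle_weight /= eq_sym (negPf Sj) eqxx.
have [q jq] : exists q : int, (Posz j + 1 = Posz (ordS j) + q * N.+3)%R.
  by case: (ordSE j) => [->|[-> ->]]; [exists 0%R|exists 1%R]; lia.
exact: (fK (j, i') (ordS j, k') r 1%R q rQ isT jq wS).
Qed.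

(** * Finite determination by quantifier elimination *)

Lemma sat_rename (S : Type) (M : structure S) (V W : Type) (h : V -> W) (phi : formula S V)
    (a : W -> M) : sat a (rename h phi) <-> sat (a \o h) phi.
Proof.
elim: phi W h a => //= {}V f.
- by move=> IHf g IHg W h a; rewrite IHf IHg.
- move=> IH W h a; suff E m : oapp (a \o h) m = oapp a m \o omap h :> (_ -> M).
    by split=> H m; move: (H m); rewrite IH E.
  by apply/funext; case.
Qed.

Lemma rename_comp (S V W X : Type) (h : V -> W) (k : W -> X) (phi : formula S V) :
  rename k (rename h phi) = rename (k \o h) phi.
Proof.
elim: phi W X h k => //= {}V f.
- by move=> IHf g IHg W X h k; rewrite IHf IHg.
- by move=> IH W X h k; rewrite IH; congr (FAll (rename _ _)); apply/funext; case.
Qed.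

(** The induction produces arbitrary finite types of variables, since binding a
    variable removes from the type the variables mapped to [None]; at the end they
    are renumbered. *)
Lemma formula_finite_support (S V : Type) (phi : formula S V) :
  exists (n : nat) (h : 'I_n -> V) (psi : formula S 'I_n), phi = rename h psi.
Proof.
suff [W [h [psi ->]]] : exists (W : finType) (h : W -> V) (psi : formula S W), phi = rename h psi.
  exists #|W|, (h \o enum_val), (rename enum_rank psi); rewrite rename_comp.
  by congr rename; apply/funext => w /=; rewrite enum_rankK.
elim: phi => {V} [V|V x y|V s x y|V f [W [h [f' ->]]] g [W' [h' [g' ->]]]|V f [W [h [f' ->]]]].
- by exists void, (of_void V), FFalse.
- by exists bool, (fun b => if b then x else y), (FEq true false).
- by exists bool, (fun b => if b then x else y), (FRel s true false).
- exists (W + W')%type, (fun w => match w with inl w => h w | inr w => h' w end).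
  by exists (FImp (rename inl f') (rename inr g')); rewrite /= !rename_comp.
- have /choice[h' h'P] (w : {w : W | h w}) : exists v, h (val w) = Some v.
    by case: w => w /=; case: (h w) => // v _; exists v.
  exists {w : W | h w}, h', (FAll (rename (fun w => insub w) f')).
  rewrite /= rename_comp; congr (FAll (rename _ _)); apply/funext => w /=.
  case: insubP => [w' _ <-|]; first by rewrite h'P.
  by case: (h w).
Qed.

Lemma qf_finitely_determined (S : eqType) (V : Type) (psi : formula S V) :
  quantifier_free psi ->
  exists Q : seq S, forall (M N : structure S) (a : V -> M) (b : V -> N),
    (forall x y, a x = a y <-> b x = b y) ->
    (forall s x y, s \in Q -> interp s (a x) (a y) <-> interp s (b x) (b y)) ->
    sat a psi <-> sat b psi.
Proof.
elim: psi => {V} [V _|V x y _|V s x y _|V f IHf g IHg /= [/IHf[Qf Hf] /IHg[Qg Hg]]|//].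
- by exists [::].
- by exists [::] => M N a b eqab _ /=.
- by exists [:: s] => M N a b _ relab; apply: relab; rewrite mem_head.
- exists (Qf ++ Qg) => M N a b eqab relab.
  have -> : sat a f <-> sat b f.
    by apply: Hf => // s x y sQ; apply: relab; rewrite mem_cat sQ.
  have -> // : sat a g <-> sat b g.
  by apply: Hg => // s x y sQ; apply: relab; rewrite mem_cat sQ orbT.
Qed.

(** This is the only use of quantifier elimination: without it the truth of a
    formula would depend on more than finitely many distance bounds. *)
Lemma qe_finitely_determined (S : eqType) (T : theory S) (V : choiceType)
    (phi : formula S V) : quantifier_elimination T ->
  exists (Q : seq S) (E : seq V),
  forall (M N : structure S) (a : V -> M) (b : V -> N), models M T -> models N T ->
    (forall x y, x \in E -> y \in E -> a x = a y <-> b x = b y) ->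
    (forall s x y, s \in Q -> x \in E -> y \in E ->
       interp s (a x) (a y) <-> interp s (b x) (b y)) ->
    sat a phi <-> sat b phi.
Proof.
move=> QE; have [n [h [psi ->]]] := formula_finite_support phi.
have [chi [chi_qf chiP]] := QE n psi.
have [Q QP] := qf_finitely_determined chi_qf.
exists Q, [seq h i | i <- enum 'I_n] => M N a b MT NT eqab relab.
have hE i : h i \in [seq h i | i <- enum 'I_n] by rewrite map_f ?mem_enum.
rewrite !sat_rename !chiP //; apply: QP => [x y|s x y sQ]; first exact: eqab.
exact: relab.
Qed.

(** * Ultrapowers and compactness *)

Section Ultrapower.
Variables (S J : Type) (F : set_system J) (M : structure S) (m0 : M).
Hypothesis FU : UltraFilter F.

Definition ultra_class (f : J -> M) : set (J -> M) := [set g | F [set j | f j = g j]].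

(** Equality symbols are interpreted by equality, so the carrier consists of the
    equivalence classes themselves. *)
Definition ultra_carrier := {A : set (J -> M) | exists f, A = ultra_class f}.

Definition ultra_mk (f : J -> M) : ultra_carrier :=
  exist _ (ultra_class f) (ex_intro _ f erefl).

Definition ultrapower : structure S :=
  {| carrier := ultra_carrier ;
     interp := fun s A B => exists f g, [/\ A = ultra_mk f, B = ultra_mk g &
       F [set j | interp s (f j) (g j)]] |}.

Lemma ultra_mk_surj (A : ultra_carrier) : exists f, A = ultra_mk f.
Proof. by case: A => A [f Af]; exists f; exact: eq_exist. Qed.

Lemma ultra_mkP f g : ultra_mk f = ultra_mk g <-> F [set j | f j = g j].
Proof.
split=> [[fg]|Ffg].
  have : ultra_class g g by apply: (filterS _ filterT) => j _.
  by rewrite -fg.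
apply: eq_exist; apply/seteqP; split=> h /= Fh; apply: filterS (filterI Ffg Fh) => j [/= -> //].
Qed.

(** Łoś's theorem.  In the case of a quantifier, a counterexample is chosen at each
    index where there is one; the class of this choice is a single element of the
    ultrapower, at which the universal statement can be tested. *)
Lemma los (V : Type) (phi : formula S V) (a : V -> J -> M) :
  sat (M := ultrapower) (fun v => ultra_mk (a v)) phi <-> F [set j | sat (a ^~ j) phi].
Proof.
elim: phi a => {V} [V|V x y|V s x y|V f IHf g IHg|V f IH] a.
- by split=> // /filter_not_empty.
- exact: ultra_mkP.
- split=> [[f [g [/ultra_mkP fx /ultra_mkP gy Fs]]]|Fs]; last by exists (a x), (a y).
  by apply: filterS (filterI (filterI fx gy) Fs) => j [[/= -> ->]].
- rewrite /= IHf IHg; split=> [fg|Ffg Ff]; last first.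
    by apply: filterS (filterI Ffg Ff) => j [/= H /H].
  have [/fg|nf] := in_ultra_setVsetC [set j | sat (a ^~ j) f] FU.
    by apply: filterS => j /= H _.
  by apply: filterS nf => j /= H /H.
- have lift (c : J -> M) : sat (M := ultrapower) (oapp (fun v => ultra_mk (a v)) (ultra_mk c)) f <->
      F [set j | sat (oapp (a ^~ j) (c j)) f].
    pose a' (v : option V) := oapp a c v.
    have -> : oapp (fun v => ultra_mk (a v)) (ultra_mk c) = (fun v => ultra_mk (a' v)).
      by apply/funext; case.
    rewrite IH; suff -> : [set j | sat (a'^~ j) f] = [set j | sat (oapp (a^~ j) (c j)) f] by [].
    apply/seteqP; split=> j /=; suff -> : a'^~ j = oapp (a^~ j) (c j) by [].
      by apply/funext; case.
    by apply/funext; case.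
  split=> [all_f|Ff m]; last first.
    have [c ->] := ultra_mk_surj m; apply/lift.
    by apply: filterS Ff => j /=; exact.
  have wit j : exists m : M, sat (oapp (a ^~ j) m) f -> sat (a ^~ j) (FAll f).
    have [|nall] := pselect (exists m : M, ~ sat (oapp (a ^~ j) m) f).
      by move=> [m nm]; exists m.
    by exists m0 => _ m; apply: contrapT => nm; apply: nall; exists m.
  have [c cP] := choice wit.
  by apply: filterS (iffLR (lift c) (all_f _)) => j; exact: cP.
Qed.

End Ultrapower.

(** The indices of the ultrapower are the finite lists of formulas; the ultrafilter
    contains, for each list [s], the set of the lists that include [s]. *)
Lemma compactness (S V : Type) (M : structure S) (m0 : M) (Sigma : set (formula S V)) :
  (forall s : seq {classic formula S V}, exists a : V -> M,
     forall phi : {classic formula S V}, phi \in s -> Sigma phi -> sat a phi) ->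
  consistent (Th M) Sigma.
Proof.
move=> finsat; have [a aP] := choice finsat.
pose J := seq {classic formula S V}.
pose F := filter_from [set: J] (fun s : J => [set t : J | {subset s <= t}]).
have FF : ProperFilter F.
  apply: filter_from_proper => [|s _]; last by exists s => x.
  apply: filter_from_filter; first by exists [::].
  move=> s t _ _; exists (s ++ t) => // u su.
  by split=> x xs; apply: su; rewrite mem_cat xs ?orbT.
have [G [GU FG]] := ultraFilterLemma FF.
exists (ultrapower G M).
  move=> phi Mphi; rewrite /Th /mkset.
  have satphi : sat (M := ultrapower G M) (fun v => ultra_mk G (fun=> of_void M v)) phi.
    apply/(los m0 GU phi (fun v _ => of_void M v)).
    by apply: filterS filterT => j _; exact: Mphi.
  suff <- : (fun v => ultra_mk G (fun=> of_void M v)) = of_void (ultrapower G M) by [].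
  by apply/funext; case.
exists (fun v => ultra_mk G (fun j => a j v)) => phi Sphi.
apply/(los m0 GU phi (fun v j => a j v)); apply: FG.
exists [:: phi : {classic formula S V}] => // j /(_ phi (mem_head _ _)) phij.
exact: aP.
Qed.

(** * Indiscernible sequences in models of the theory *)

Section Models.
Variables (d : Order.disp_t) (R : distanceMonoid d) (U : metric_space R).
Variable M : structure R.
Hypothesis MU : models M (Th (metric_structure U)).

(** Each axiom of metric spaces with distances bounded by constants of [R] is a
    sentence true in [U], and therefore passes to all models, whose distances may be
    cuts of [R] rather than elements. *)
Lemma model_eq0 (x y : M) : x = y <-> interp (dm0 R) x y.
Proof.
have U0 (u v : U) : u = v <-> dist u v <= dm0 R.
  by rewrite -dist_eq0; split=> [->//|?]; apply/eqP; rewrite eq_le dm_ge0 andbT.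
pose x0 : option (option void) := Some None; pose x1 : option (option void) := None.
split.
  by apply: (MU (_ : Th _ (FAll (FAll (FImp (FEq x0 x1) (FRel (dm0 R) x0 x1)))))) => u v /= /U0.
by apply: (MU (_ : Th _ (FAll (FAll (FImp (FRel (dm0 R) x0 x1) (FEq x0 x1)))))) => u v /= /U0.
Qed.

Lemma model_mono (r s : R) (x y : M) : r <= s -> interp r x y -> interp s x y.
Proof.
move=> rs; pose x0 : option (option void) := Some None; pose x1 : option (option void) := None.
apply: (MU (_ : Th _ (FAll (FAll (FImp (FRel r x0 x1) (FRel s x0 x1)))))) => u v /= ur.
exact: le_trans ur rs.
Qed.

Lemma model_top (r : R) (x y : M) : (forall s : R, s <= r) -> interp r x y.
Proof.
move=> rtop; pose x0 : option (option void) := Some None; pose x1 : option (option void) := None.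
by apply: (MU (_ : Th _ (FAll (FAll (FRel r x0 x1))))) => u v /=.
Qed.

Lemma model_sym (r : R) (x y : M) : interp r x y -> interp r y x.
Proof.
pose x0 : option (option void) := Some None; pose x1 : option (option void) := None.
by apply: (MU (_ : Th _ (FAll (FAll (FImp (FRel r x0 x1) (FRel r x1 x0)))))) => u v /=;
  rewrite dist_sym.
Qed.

Lemma model_triangle (r s : R) (x y z : M) :
  interp r x y -> interp s y z -> interp (oplus R r s) x z.
Proof.
pose x0 : option (option (option void)) := Some (Some None).
pose x1 : option (option (option void)) := Some None.
pose x2 : option (option (option void)) := None.
apply: (MU (_ : Th _ (FAll (FAll (FAll
  (FImp (FRel r x0 x1) (FImp (FRel s x1 x2) (FRel (oplus R r s) x0 x2)))))))) => u v w /= uv vw.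
exact: le_trans (dist_triangle u v w) (le_oplus uv vw).
Qed.

Variables (I : Type) (a : nat -> I -> M).
Hypothesis aI : indiscernible a.

(** The boolean tells whether a variable belongs to the earlier or to the later of
    the two tuples. *)
Lemma indiscernible_pair (V : Type) (phi : formula R (bool * V)) (h : V -> I) s t s' t' :
  (s < t)%N -> (s' < t')%N ->
  sat (fun v : bool * V => a (if v.1 then t else s) (h v.2)) phi <->
  sat (fun v : bool * V => a (if v.1 then t' else s') (h v.2)) phi.
Proof.
move=> st st'; pose g (k l : nat) (j : 'I_2) := if val j == 0%N then k else l.
have gI k l : (k < l)%N -> forall i j : 'I_2, (i < j)%N -> (g k l i < g k l j)%N.
  by move=> kl [[|[|i]] hi] [[|[|j]] hj].
pose f (v : bool * V) := (if v.1 then ord_max else ord0 : 'I_2, h v.2).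
have E := aI (gI _ _ st) (gI _ _ st').
have := congr1 (fun T : set _ => T (rename f phi)) E; rewrite /tp /mkset => {}E.
have gE k l : (fun v : bool * V => a (if v.1 then l else k) (h v.2)) =
    (fun v : 'I_2 * I => a (g k l v.1) v.2) \o f.
  by apply/funext => -[[] v].
by rewrite (gE s t) (gE s' t') -!sat_rename E.
Qed.

Lemma indiscernible_level (V : Type) (phi : formula R V) (h : V -> I) s t :
  sat (fun v => a s (h v)) phi <-> sat (fun v => a t (h v)) phi.
Proof.
have gI k : forall i j : 'I_1, (i < j)%N -> (k < k)%N by move=> i j; rewrite !ord1.
have E := aI (gI s) (gI t).
pose f (v : V) : 'I_1 * I := (ord0, h v).
have := congr1 (fun T : set _ => T (rename f phi)) E; rewrite /tp /mkset => {}E.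
have fE k : sat (fun v : 'I_1 * I => a k v.2) (rename f phi) <-> sat (fun v => a k (h v)) phi.
  exact: sat_rename.
by rewrite -(fE s) -(fE t) E.
Qed.

Definition lag (r : R) (z : int) (i j : I) : Prop :=
  match z with
  | Posz n => interp r (a 0 i) (a n j)
  | Negz n => interp r (a n.+1 i) (a 0 j)
  end.

Lemma lagE r k l i j : interp r (a k i) (a l j) <-> lag r (Posz l - Posz k)%R i j.
Proof.
have pair s t s' t' : (s < t)%N -> (s' < t')%N ->
    interp r (a s i) (a t j) <-> interp r (a s' i) (a t' j).
  move=> st st'.
  exact: (indiscernible_pair (FRel r (false, false) (true, true))
    (fun b : bool => if b then j else i) st st').
have pair' s t s' t' : (s < t)%N -> (s' < t')%N ->
    interp r (a t i) (a s j) <-> interp r (a t' i) (a s' j).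
  move=> st st'.
  exact: (indiscernible_pair (FRel r (true, true) (false, false))
    (fun b : bool => if b then i else j) st st').
have [kl|lk|->] := ltngtP k l.
- have -> : (Posz l - Posz k = Posz (l - k))%R by lia.
  by apply: pair; lia.
- have -> : (Posz l - Posz k = Negz (k - l).-1)%R by lia.
  by apply: pair'; lia.
- rewrite GRing.subrr /=.
  exact: (indiscernible_level (FRel r false true) (fun b : bool => if b then j else i)).
Qed.

Lemma lag_levels z : exists k l : nat, z = (Posz l - Posz k)%R.
Proof. by case: z => n; [exists 0%N, n|exists n.+1, 0%N]; lia. Qed.

Lemma lag_metric_indiscernible : lag_metric (NP a) lag.
Proof.
split.
- by move=> r s [] n i j; exact: model_mono.
- by move=> r [] n i j; exact: model_top.
- by move=> i; exact/model_eq0.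
- move=> r z i j; have [k [l ->]] := lag_levels z.
  have -> : (- (Posz l - Posz k) = Posz k - Posz l)%R by lia.
  by rewrite -!lagE; exact: model_sym.
- move=> r s y z i j k; have [l1 [l2 ->]] := lag_levels y.
  have [m1 [m2 ->]] := lag_levels z.
  have -> : (Posz l2 - Posz l1 = Posz (l2 + m1) - Posz (l1 + m1))%R by lia.
  have -> : (Posz m2 - Posz m1 = Posz (l2 + m2) - Posz (l2 + m1))%R by lia.
  have -> : (Posz (l2 + m1) - Posz (l1 + m1) + (Posz (l2 + m2) - Posz (l2 + m1)) =
             Posz (l2 + m2) - Posz (l1 + m1))%R by lia.
  by rewrite -!lagE; exact: model_triangle.
- move=> r y z i y0 Ky.
  have pos s t : (s < t)%N -> interp r (a s i) (a t i).
    move=> st.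
    have [k [l [kl Kkl]]] : exists k l, (k < l)%N /\ interp r (a k i) (a l i).
      have [k [l yE]] := lag_levels y; move: Ky; rewrite yE -lagE => Ky.
      have [kl|lk|kl] := ltngtP k l; first by exists k, l.
        by exists l, k; split=> //; exact: model_sym.
      by move: y0; rewrite yE kl GRing.subrr.
    exact/(indiscernible_pair (FRel r (false, tt) (true, tt)) (fun=> i) st kl).
  case: z => [[|n]|n] /=; [|exact: pos|exact/model_sym/pos].
  by apply: (model_mono (dm_ge0 r)); exact/model_eq0.
- move=> z i /contrapT ai; have [k [l ->]] := lag_levels z.
  have pos s t : (s < t)%N -> a s i = a t i.
    by move=> st; apply/(indiscernible_pair (FEq (false, tt) (true, tt)) (fun=> i) st (ltn0Sn 0)).
  rewrite -lagE; apply/model_eq0.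
  by have [kl|lk|->//] := ltngtP k l; [exact: pos|exact/esym/pos].
Qed.

End Models.

Lemma finite_set_pigeonhole (T : eqType) (A : set T) : finite_set A ->
  exists N, forall f : 'I_N -> T, injective f -> exists k, ~ A (f k).
Proof.
move=> /finite_seqP[s ->]; exists (size s).+1 => f finj; apply: contrapT => nf.
have fs : {subset codom f <= s}.
  by move=> _ /codomP[k ->]; apply: contrapT => fk; apply: nf; exists k.
have fU : uniq (codom f) by rewrite map_inj_uniq ?enum_uniq.
by have := uniq_leq_size fU fs; rewrite size_codom card_ord ltnn.
Qed.

(** * Cyclic types *)

Section CyclicType.
Variables (d : Order.disp_t) (R : distanceMonoid d) (U : metric_space R).
Variables (M : structure R) (I : choiceType) (a : nat -> I -> M) (n : nat).
Hypothesis MU : models M (Th (metric_structure U)).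
Hypothesis aI : indiscernible a.
Hypothesis QE : quantifier_elimination (Th (metric_structure U)).

(** Level [j] of [b] is meant to realize the variables [x^j] of the cyclic type; only
    distances inside a level and to the next level are constrained by it. *)
Definition cyclic_agreement (Q : seq R) (E : seq I) (b : 'I_n * I -> U) : Prop :=
  forall r j i k, r \in Q -> i \in E -> k \in E ->
    (dist (b (j, i)) (b (j, k)) <= r <-> lag a r 0 i k) /\
    (dist (b (j, i)) (b (ordS j, k)) <= r <-> lag a r 1 i k).

Let Sigma := \bigcup_(j in [set: 'I_n]) subst_type (type01 a) j (ordS j).

(** The two halves of the variables of [p(x^j, x^(j+1))] lie at levels [j] and
    [ordS j].  Distances inside the second half are those of [a^1], which have the
    same cuts as those of [a^0] by indiscernibility. *)
Lemma cyclic_formula_determined (phi : formula R ('I_n * I)) : Sigma phi ->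
  exists Q E, forall b, cyclic_agreement Q E b -> sat (M := metric_structure U) b phi.
Proof.
case=> j _ [phi0 phi0P <-] {phi}.
have [Q [E QEP]] := qe_finitely_determined phi0 QE.
pose strip (v : I + I) := match v with inl i => i | inr i => i end.
pose h (v : I + I) := match v with inl i => (j, i) | inr i => (ordS j, i) end.
pose a01 (v : I + I) := match v with inl i => a 0 i | inr i => a 1 i end.
exists (dm0 R :: Q), (map strip E) => b bP; apply/(sat_rename h).
(* [Q] is enlarged by zero so that it also controls equality of points. *)
have UU : models (metric_structure U) (Th (metric_structure U)) by [].
have relab r x y : r \in dm0 R :: Q -> x \in E -> y \in E ->
    interp r (a01 x) (a01 y) <-> dist (b (h x)) (b (h y)) <= r.
  move=> rQ xE yE; have agr l := bP r l (strip x) (strip y) rQ (map_f _ xE) (map_f _ yE).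
  have agr' l := bP r l (strip y) (strip x) rQ (map_f _ yE) (map_f _ xE).
  case: x y xE yE agr agr' => [i|i] [k|k] _ _ /= agr agr'.
  - by rewrite (agr j).1.
  - by rewrite (agr j).2.
  - rewrite dist_sym (agr' j).2; split; exact: (model_sym MU).
  - by rewrite (agr (ordS j)).1 (lagE aI).
apply/(QEP M (metric_structure U) a01 (b \o h) MU UU) => // [x y xE yE|r x y rQ].
  rewrite (model_eq0 MU) (model_eq0 UU); apply: relab => //; exact: mem_head.
by apply: relab; rewrite inE rQ orbT.
Qed.

Lemma cyclic_finite_determined (s : seq {classic formula R ('I_n * I)}) :
  exists Q E, forall b, cyclic_agreement Q E b ->
    forall phi : {classic formula R ('I_n * I)}, phi \in s -> Sigma phi ->
      sat (M := metric_structure U) b phi.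
Proof.
elim: s => [|phi s [Q [E IH]]]; first by exists [::], [::].
have [Sphi|nSphi] := pselect (Sigma phi); last first.
  exists Q, E => b /IH H psi; rewrite inE => /orP[/eqP->//|]; exact: H.
have [Q' [E' phiP]] := cyclic_formula_determined Sphi.
exists (Q' ++ Q), (E' ++ E) => b bP psi; rewrite inE => /orP[/eqP-> _|].
  by apply: phiP => r j i k rQ iE kE; apply: bP; rewrite mem_cat ?rQ ?iE ?kE.
by apply: IH => r j i k rQ iE kE; apply: bP; rewrite mem_cat ?rQ ?iE ?kE orbT.
Qed.

End CyclicType.

Lemma indiscernible_cyclic (d : Order.disp_t) (R : distanceMonoid d) (U : metric_space R)
    (M : structure R) (I : choiceType) (a : nat -> I -> M) :
  quantifier_elimination (Th (metric_structure U)) -> finitely_universal U ->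
  models M (Th (metric_structure U)) -> indiscernible a -> finite_set (NP a) ->
  exists2 n, (0 < n)%N & cyclic_seq (Th (metric_structure U)) a n.
Proof.
move=> QE univ MU aI /finite_set_pigeonhole[N pigeon].
have [u0 _] := finitely_universal_inhabited univ.
exists N.+3 => //; apply: (compactness (M := metric_structure U) u0) => s.
have [Q [E QEP]] := cyclic_finite_determined MU aI QE s.
have [b bP] := cyclic_lag_realization E Q univ (lag_metric_indiscernible MU aI) pigeon.
by exists b; exact: QEP.
Qed.

Theorem theorem2 (d : Order.disp_t) (R : distanceMonoid d) (U : metric_space R) :
  urysohn_monoid R -> is_urysohn_space U ->
  ~ finitary_strong_order_property (Th (metric_structure U)).
Proof.
move=> [_ QE] UU [M [I [a [MU aI NPfin ncyc]]]].
have [_ _ univ] := UU.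
have [n n0 cyc] := indiscernible_cyclic (I := {classic I}) (QE U UU) univ MU aI NPfin.
exact: ncyc n0 cyc.
Qed.
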